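(* If $H$ is a connected graph such that $H\prec G$ for every cubic graph $G$, then $H\simeq S_{10}$.
   Context: Graphs are finite, undirected and loopless, but may contain parallel edges (both $H$ and the cubic graphs $G$); $\simeq$ denotes isomorphism of (multi)graphs. For a vertex $u$ of a graph $G$, $\partial_G u$ denotes the set of edges of $G$ incident to $u$. An $H$-colouring of $G$ is a map $f:E(G)\to E(H)$ that is a proper edge-colouring (adjacent edges of $G$ receive distinct edges of $H$) such that for every $u\in V(G)$ there exists $v\in V(H)$ with $f(\partial_G u)=\partial_H v$. We write $H\prec G$ ($H$ colours $G$) if $G$ admits an $H$-colouring. $S_{10}$ (the Sylvester graph) is the cubic multigraph on the ten vertices $z$ and $u^i,v^i,w^i$ ($i\in\{1,2,3\}$) whose edges are, for each $i\in\{1,2,3\}$: two parallel edges between $v^i$ and $w^i$, one edge $u^iv^i$, one edge $u^iw^i$, and one edge $u^iz$. *)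

(* Defs.v *)
From HB Require Import structures.
From mathcomp Require Import all_boot.

Set Implicit Arguments.
Unset Strict Implicit.
Unset Printing Implicit Defensive.

(* Finite loopless multigraphs.  Distinct edges may have the same set of ends
   (parallel edges); a loop is excluded because its set of ends would be a
   singleton. *)
Record mgraph := MGraph {
  vertex : finType;
  edge : finType;
  ends : edge -> {set vertex};
  card_ends : forall e, #|ends e| = 2
}.

Definition incident (G : mgraph) (u : vertex G) : {set edge G} :=
  [set e | u \in ends e].

Definition cubic (G : mgraph) : Prop :=
  forall u : vertex G, #|incident u| = 3.

Definition adjacent (G : mgraph) : rel (vertex G) :=
  fun x y => [exists e : edge G, ends e == [set x; y]].

(* The null graph counts as connected. *)
Definition connected (G : mgraph) : Prop :=
  forall x y : vertex G, connect (@adjacent G) x y.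

Definition isomorphic (G H : mgraph) : Prop :=
  exists (phi : vertex G -> vertex H) (psi : edge G -> edge H),
    [/\ bijective phi, bijective psi
      & forall e : edge G, ends (psi e) = phi @: ends e].

Definition adjacent_edges (G : mgraph) (e e' : edge G) : Prop :=
  e <> e' /\ exists u : vertex G, u \in ends e /\ u \in ends e'.

Definition proper_edge_colouring (G : mgraph) (C : Type) (f : edge G -> C) :
    Prop :=
  forall e e' : edge G, adjacent_edges e e' -> f e <> f e'.

Definition is_colouring (H G : mgraph) (f : edge G -> edge H) : Prop :=
  proper_edge_colouring f /\
  forall u : vertex G, exists v : vertex H, f @: incident u = incident v.

(* [colours H G] is the relation H \prec G. *)
Definition colours (H G : mgraph) : Prop :=
  exists f : edge G -> edge H, is_colouring f.

Inductive S10_vertex : Type :=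
  | S10_z
  | S10_u of 'I_3
  | S10_v of 'I_3
  | S10_w of 'I_3.

(* [S10_vw i b], for b : bool, are the two parallel edges between v^i, w^i. *)
Inductive S10_edge : Type :=
  | S10_vw of 'I_3 & bool
  | S10_uv of 'I_3
  | S10_uw of 'I_3
  | S10_uz of 'I_3.

Definition S10_vertex_code (x : S10_vertex) : option ('I_3 + 'I_3 + 'I_3) :=
  match x with
  | S10_z => None
  | S10_u i => Some (inl (inl i))
  | S10_v i => Some (inl (inr i))
  | S10_w i => Some (inr i)
  end.

Definition S10_vertex_decode (c : option ('I_3 + 'I_3 + 'I_3)) : S10_vertex :=
  match c with
  | None => S10_z
  | Some (inl (inl i)) => S10_u i
  | Some (inl (inr i)) => S10_v i
  | Some (inr i) => S10_w i
  end.

Lemma S10_vertex_codeK : cancel S10_vertex_code S10_vertex_decode.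
Proof. by case. Qed.

HB.instance Definition _ := Finite.copy S10_vertex (can_type S10_vertex_codeK).

Definition S10_edge_code (e : S10_edge) : 'I_3 * bool + 'I_3 + 'I_3 + 'I_3 :=
  match e with
  | S10_vw i b => inl (inl (inl (i, b)))
  | S10_uv i => inl (inl (inr i))
  | S10_uw i => inl (inr i)
  | S10_uz i => inr i
  end.

Definition S10_edge_decode (c : 'I_3 * bool + 'I_3 + 'I_3 + 'I_3) : S10_edge :=
  match c with
  | inl (inl (inl (i, b))) => S10_vw i b
  | inl (inl (inr i)) => S10_uv i
  | inl (inr i) => S10_uw i
  | inr i => S10_uz i
  end.

Lemma S10_edge_codeK : cancel S10_edge_code S10_edge_decode.
Proof. by case. Qed.

HB.instance Definition _ := Finite.copy S10_edge (can_type S10_edge_codeK).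

Definition S10_ends (e : S10_edge) : {set S10_vertex} :=
  match e with
  | S10_vw i _ => [set S10_v i; S10_w i]
  | S10_uv i => [set S10_u i; S10_v i]
  | S10_uw i => [set S10_u i; S10_w i]
  | S10_uz i => [set S10_u i; S10_z]
  end.

Lemma card_S10_ends (e : S10_edge) : #|S10_ends e| = 2.
Proof. by case: e => [i b|i|i|i]; rewrite cards2. Qed.

Definition S10 : mgraph := MGraph card_S10_ends.

(* Main.v *)
Require Import Defs.
From mathcomp Require Import all_boot.

Set Implicit Arguments.
Unset Strict Implicit.
Unset Printing Implicit Defensive.

(** Only G = S10 is needed. Let f be an H-colouring of S10 and choose phi y
    with f(∂y) = ∂(phi y) for every vertex y. If phi is injective then
    f maps the ends of e to the ends of f e, the image of phi is closed under
    adjacency, and connectedness makes (phi, f) an isomorphism. For the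
    injectivity, colouring the two parallel edges v^i w^i properly forces
    phi u^i, phi v^i, phi w^i to span a copy of the corresponding block of S10,
    and the edges f(u^i z) attach these three blocks to phi z. *)

(** * Isomorphisms obtained from vertex-injective colourings *)

Lemma isomorphic_sym (G H : mgraph) : isomorphic G H -> isomorphic H G.
Proof.
move=> [phi [psi [[phi' phiK phi'K] [psi' psiK psi'K] endsE]]].
exists phi', psi'; split; [by exists phi | by exists psi |] => e.
by rewrite -{2}(psi'K e) endsE -imset_comp (eq_imset _ phiK) imset_id.
Qed.

Lemma ends_incident (G : mgraph) (x y : vertex G) (e : edge G) :
  x != y -> e \in incident x -> e \in incident y -> ends e = [set x; y].
Proof.
rewrite !inE => neq_xy ex ey; apply/esym/eqP.
by rewrite eqEcard subUset !sub1set ex ey card_ends cards2 neq_xy.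
Qed.

Lemma colouring_incident_inj (G H : mgraph) (f : edge G -> edge H)
    (u : vertex G) :
  proper_edge_colouring f -> {in incident u &, injective f}.
Proof.
move=> fproper e e'; rewrite !inE => eu e'u fee'.
case: (eqVneq e e') => // /eqP ne.
by case: (fproper e e') => //; split=> //; exists u.
Qed.

Lemma injective_colouring_isomorphic (G H : mgraph) (f : edge G -> edge H)
    (phi : vertex G -> vertex H) (y0 : vertex G) :
    connected H -> proper_edge_colouring f ->
    (forall y, f @: incident y = incident (phi y)) -> injective phi ->
  isomorphic G H.
Proof.
move=> Hconn fproper phiE phi_inj.
(* Both ends of [e] go to ends of [f e]; since [phi] keeps them distinct, they are all of them. *)
have endsE e : ends (f e) = phi @: ends e.
  apply/esym/eqP; rewrite eqEcard card_imset // !card_ends leqnn andbT.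
  apply/subsetP=> _ /imsetP[y ey ->].
  have : f e \in incident (phi y) by rewrite -phiE imset_f // inE.
  by rewrite inE.
have f_onto x g : x \in codom phi -> x \in ends g -> exists e, g = f e.
  case/codomP=> y -> yg.
  have : g \in f @: incident y by rewrite phiE inE.
  by case/imsetP=> e _ ->; exists e.
have phi_onto x : x \in codom phi.
  have cl : closed (@adjacent H) (codom phi).
    apply: intro_closed => [a b|a b].
      apply: sym_connect_sym => {}a {}b.
      by apply/existsP/existsP=> -[e /eqP he]; exists e; rewrite he setUC.
    case/existsP=> g /eqP gE acod.
    have [|e ge] := f_onto _ g acod; first by rewrite gE set21.
    have : b \in ends g by rewrite gE set22.
    by rewrite ge endsE => /imsetP[y _ ->]; apply: codom_f.
  (* The vertex [y0] makes the image of [phi] nonempty; connectedness then spreads the image over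
     all of [H]. *)
  by rewrite -(closed_connect cl (Hconn (phi y0) x)) codom_f.
(* Edges with the same image have the same ends, and properness at a common end forces them to be
   equal. *)
have f_inj : injective f.
  move=> e e' fee'.
  have eE : ends e = ends e'.
    by apply: (imset_inj phi_inj); rewrite -!endsE fee'.
  have /card_gt0P[y ey] : 0 < #|ends e| by rewrite card_ends.
  apply: (colouring_incident_inj (u := y) fproper) => //; rewrite inE //.
  by rewrite -eE.
have f_surj g : g \in codom f.
  have /card_gt0P[x xg] : 0 < #|ends g| by rewrite card_ends.
  by have [e ->] := f_onto _ _ (phi_onto x) xg; apply: codom_f.
exists phi, f; split=> //.
  by apply: (Bijective (g := fun x => iinv (phi_onto x))) => x;
    [apply: phi_inj|]; rewrite f_iinv.
by apply: (Bijective (g := fun x => iinv (f_surj x))) => x;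
  [apply: f_inj|]; rewrite f_iinv.
Qed.

(** * Regularity of the Sylvester graph *)

Lemma cubic_S10 : cubic S10.
Proof.
have incidentE (y : vertex S10) (d1 d2 d3 : edge S10) :
    uniq [:: d1; d2; d3] ->
    (forall d, (y \in ends d) = (d \in [:: d1; d2; d3])) -> #|incident y| = 3.
  move=> d_uniq dE; apply: etrans (card_uniqP d_uniq).
  by apply: eq_card => d; rewrite inE dE.
have vwE i j b b' : (S10_vw i b == S10_vw j b') = (i == j) && (b == b') by [].
case=> [|i|i|i].
- have uz_inj : injective (S10_uz : 'I_3 -> edge S10) by move=> j k [].
  rewrite -(card_ord 3) -(card_imset _ uz_inj).
  apply: eq_card => -[j b|j|j|j]; rewrite !inE.
  + by apply/esym/imsetP=> -[].
  + by apply/esym/imsetP=> -[].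
  + by apply/esym/imsetP=> -[].
  + by rewrite mem_imset.
- apply: (@incidentE _ (S10_uz i) (S10_uv i) (S10_uw i)) => //.
  by case=> [j b|j|j|j]; rewrite !inE //= ?orbF [RHS]eq_sym.
- apply: (@incidentE _ (S10_vw i true) (S10_vw i false) (S10_uv i)).
    by rewrite /= !inE !vwE andbF.
  by case=> [j []|j|j|j]; rewrite !inE ?vwE ?andbT ?andbF /= ?orbF // [RHS]eq_sym.
- apply: (@incidentE _ (S10_vw i true) (S10_vw i false) (S10_uw i)).
    by rewrite /= !inE !vwE andbF.
  by case=> [j []|j|j|j]; rewrite !inE ?vwE ?andbT ?andbF /= ?orbF // [RHS]eq_sym.
Qed.

(** * Colourings of [S10] and their action on vertices *)

Section SylvesterColouring.

Variables (H : mgraph) (f : edge S10 -> edge H) (phi : vertex S10 -> vertex H).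
Hypothesis fproper : proper_edge_colouring f.
Hypothesis phiE : forall y, f @: incident y = incident (phi y).

Implicit Types (i j : 'I_3) (b s : bool) (g : edge H).

(* The boolean s selects v^i or w^i, which a symmetry of S10 exchanges. *)
Let p i s := phi (if s then S10_v i else S10_w i).
Let r i := phi (S10_u i).
Let x := phi S10_z.
Let a i b := f (S10_vw i b).
Let c i s := f (if s then S10_uv i else S10_uw i).
Let e i := f (S10_uz i).

Let incidentP y g :
  reflect (exists2 d : edge S10, y \in ends d & g = f d) (g \in incident (phi y)).
Proof.
rewrite -phiE; apply: (iffP imsetP) => -[d dy ->]; exists d => //.
  by rewrite inE in dy.
by rewrite inE.
Qed.

Let f_incident y (d : edge S10) : y \in ends d -> f d \in incident (phi y).
Proof. by move=> yd; apply/incidentP; exists d. Qed.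

Let f_neq y (d d' : edge S10) :
  y \in ends d -> y \in ends d' -> d != d' -> f d != f d'.
Proof.
move=> yd yd'; apply: contraNneq => fE; apply/eqP.
by apply: (colouring_incident_inj (u := y) fproper) => //; rewrite inE.
Qed.

Let pa i s b : a i b \in incident (p i s).
Proof. by case: s; apply: f_incident; [apply: set21 | apply: set22]. Qed.

Let pc i s : c i s \in incident (p i s).
Proof. by case: s; apply: f_incident; apply: set22. Qed.

Let rc i s : c i s \in incident (r i).
Proof. by case: s; apply: f_incident; apply: set21. Qed.

Let re i : e i \in incident (r i).
Proof. by apply: f_incident; apply: set21. Qed.

Let xe i : e i \in incident x.
Proof. by apply: f_incident; apply: set22. Qed.

Let pE i s g : g \in incident (p i s) -> (exists b, g = a i b) \/ g = c i s.
Proof.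
case/incidentP=> d yd ->; case: s d yd => -[j b|j|j|j];
  rewrite !inE ?orbF //= => /eqP[->]; by [left; exists b | right].
Qed.

Let rE i g : g \in incident (r i) -> g = e i \/ exists s, g = c i s.
Proof.
case/incidentP=> d yd ->; case: d yd => [j b|j|j|j];
  rewrite !inE ?orbF //= => /eqP[->];
  by [left | right; exists true | right; exists false].
Qed.

Let ac i b s : a i b != c i s.
Proof.
by case: s; [apply: (f_neq (y := S10_v i))|apply: (f_neq (y := S10_w i))];
  rewrite ?set21 ?set22.
Qed.

Let ec i s : e i != c i s.
Proof. by case: s; apply: (f_neq (y := S10_u i)); rewrite ?set21. Qed.

Let cc i s : c i s != c i (~~ s).
Proof. by case: s; apply: (f_neq (y := S10_u i)); rewrite ?set21. Qed.

Let ee i j : i != j -> e i != e j.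
Proof. by move=> ij; apply: (f_neq (y := S10_z)); rewrite ?set22. Qed.

(** If the two vertices agreed, [c i (~~ s)] would be an edge at [p i s], so a parallel edge or
    [c i s]; properness excludes both. The same argument gives [pr]. *)
Let pp i s : p i s != p i (~~ s).
Proof.
apply/eqP=> pE'; have := pc i (~~ s); rewrite -pE' => /pE[[b /eqP]|/eqP].
  by rewrite eq_sym (negPf (ac _ _ _)).
by rewrite eq_sym (negPf (cc _ _)).
Qed.

Let endsa i b s : ends (a i b) = [set p i s; p i (~~ s)].
Proof. exact: ends_incident (pp i s) (pa i s b) (pa i (~~ s) b). Qed.

Let pr i s : p i s != r i.
Proof.
apply/eqP=> pE'; have := rc i (~~ s); rewrite -pE' => /pE[[b /eqP]|/eqP].
  by rewrite eq_sym (negPf (ac _ _ _)).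
by rewrite eq_sym (negPf (cc _ _)).
Qed.

Let endsc i s : ends (c i s) = [set p i s; r i].
Proof. exact: ends_incident (pr i s) (pc i s) (rc i s). Qed.

Let a_notin_r i b : a i b \notin incident (r i).
Proof. by rewrite inE (endsa i b true) !inE !(eq_sym (r i)) !(negPf (pr _ _)). Qed.

Let block i := [set p i true; p i false; r i].

Let p_block i s : p i s \in block i.
Proof. by case: s; rewrite !inE eqxx ?orbT. Qed.

Let r_block i : r i \in block i.
Proof. by rewrite !inE eqxx orbT. Qed.

Let endsc_block i s : ends (c i s) \subset block i.
Proof. by rewrite endsc subUset !sub1set p_block r_block. Qed.

(** A block can thus be left only through [r i], which is what later keeps distinct blocks apart. *)
Let p_closed i s g : g \in incident (p i s) -> ends g \subset block i.
Proof.
case/pE=> [[b ->]|->] //.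
by rewrite (endsa i b true) subUset !sub1set !p_block.
Qed.

(** If [e j] were [c i s], both edges [c j _] would be among the parallel edges [a i _] and share
    their ends, although [p j true] and [p j false] differ. *)
Let e_neq_c i j s : r j = p i s -> e j != c i s.
Proof.
move=> rp; apply/eqP=> eE.
have par s' : ends (c j s') = [set p i s; p i (~~ s)].
  have := rc j s'; rewrite rp => /pE[[b ->]|cE]; first exact: endsa.
  by have := ec j s'; rewrite cE eE eqxx.
have: p j true \in ends (c j false) by rewrite par -(par true) endsc set21.
by rewrite endsc !inE (negPf (pp j true)) (negPf (pr _ _)).
Qed.

(* If x = r i, then a second block would also have its vertex r at x, and both
   blocks would share the third edge at x, hence also their parallel edges. *)
Let xr i : x != r i.
Proof.
apply/eqP=> xri.
have [j ji] : exists j, j != i.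
  exists (inord (i == 0 :> nat)).
  by rewrite -val_eqE /= inordK; case: i {xri} => -[|[|]].
have [s ejc] : exists s, e j = c i s.
  by have := xe j; rewrite xri => /rE[/eqP|//]; rewrite (negPf (ee ji)).
have rji : r j = r i.
  have := re j; rewrite inE ejc endsc !inE => /orP[]/eqP // rp.
  by have := e_neq_c rp; rewrite ejc eqxx.
have [s' eic] : exists s', e i = c j s'.
  by have := re i; rewrite -rji => /rE[/eqP|//]; rewrite eq_sym (negPf (ee ji)).
(* The edges at the common vertex are [e i], [e j] and a third one, which is [c i (~~ s)] from one
   block and [c j (~~ s')] from the other. *)
have cE : c i (~~ s) = c j (~~ s').
  have := rc i (~~ s); rewrite -rji => /rE[/eqP|[t cE]].
    by rewrite ejc eq_sym (negPf (cc _ _)).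
  have [tE|tE] : t = s' \/ t = ~~ s' by case: (t) (s') => -[]; auto.
    by have := ec i (~~ s); rewrite cE tE eic eqxx.
  by rewrite cE tE.
have pE1 : p i (~~ s) = p j (~~ s').
  have : p i (~~ s) \in ends (c j (~~ s')) by rewrite -cE endsc set21.
  by rewrite endsc !inE rji (negPf (pr _ _)) orbF => /eqP.
have aE : exists b, a j true = a i b.
  have := pa j (~~ s') true; rewrite -pE1 => /pE[//|/eqP].
  by rewrite cE (negPf (ac _ _ _)).
have pE2 : p j s' = p i s.
  case: aE => b aE.
  have : p j s' \in ends (a i b) by rewrite -aE (endsa _ _ s') set21.
  by rewrite (endsa _ _ s) !inE pE1 (negPf (pp _ _)) orbF => /eqP.
(* The edge [c j s'], which is [e i], now lies at [p i s]. As a parallel edge it would miss [r i];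
   as [c i s] it would equal [e j]. *)
have := pc j s'; rewrite pE2 => /pE[[b cb]|cE'].
  by have := a_notin_r i b; rewrite -cb -rji rc.
by have := ee ji; rewrite ejc eic cE' eqxx.
Qed.

Let endse i : ends (e i) = [set x; r i].
Proof. exact: ends_incident (xr i) (xe i) (re i). Qed.

Let xp i s : x != p i s.
Proof.
apply/eqP=> xE'; have := xe i; rewrite xE' => /pE[[b eE]|/eqP].
  by have := a_notin_r i b; rewrite -eE re.
by rewrite (negPf (ec _ _)).
Qed.

Let x_block i : x \notin block i.
Proof. by rewrite !inE !negb_or !xp xr. Qed.

(** The edge [e i] joins [r i] to [x], outside [block j], while every edge at a vertex of [block j]
    stays inside it, except possibly [e j]. *)
Let r_notin_block i j : i != j -> r i \notin block j.
Proof.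
move=> ij; have x_ei : x \in ends (e i) by rewrite endse set21.
have not_sub : ~~ (ends (e i) \subset block j).
  by apply: contra (x_block j) => /subsetP/(_ _ x_ei).
have neq_p s : r i != p j s.
  by apply: contra not_sub => /eqP rE'; apply: (@p_closed j s); rewrite -rE' re.
have neq_r : r i != r j.
  apply: contra not_sub => /eqP rE'; have := re i; rewrite rE' => /rE[/eqP|[s ->]].
    by rewrite (negPf (ee ij)).
  exact: endsc_block.
by rewrite !inE !negb_or !neq_p neq_r.
Qed.

(** Likewise [c i s] leads from [p i s] to [r i], already known to lie outside [block j], so [p i s]
    is no [p j t]; and [r j] lies outside [block i]. *)
Let p_notin_block i j s : i != j -> p i s \notin block j.
Proof.
move=> ij; have r_ci : r i \in ends (c i s) by rewrite endsc set22.
have not_sub : ~~ (ends (c i s) \subset block j).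
  by apply: contra (r_notin_block ij) => /subsetP/(_ _ r_ci).
have p_neq t : p i s != p j t.
  by apply: contra not_sub => /eqP pE'; apply: (@p_closed j t); rewrite -pE' pc.
have pi_rj : p i s != r j.
  have : r j \notin block i by rewrite r_notin_block // eq_sym.
  by rewrite eq_sym; apply: contraNneq => ->; apply: p_block.
by rewrite !inE !negb_or !p_neq.
Qed.

Lemma S10_colouring_vertex_inj : injective phi.
Proof.
have block_inj i j y y' : y \in block i -> y' \in block j -> y = y' -> i = j.
  move=> yi yj yy'; rewrite -{}yy' in yj; apply/eqP; apply: contraLR yj => ij.
  rewrite !inE -orbA in yi.
  by case/or3P: yi => /eqP->; rewrite ?p_notin_block ?r_notin_block.
(* The facts are restated on the constructors of [S10_vertex] to serve the case analysis below. *)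
have u_in i : phi (S10_u i) \in block i := r_block i.
have v_in i : phi (S10_v i) \in block i := p_block i true.
have w_in i : phi (S10_w i) \in block i := p_block i false.
have z_notin i : phi S10_z \notin block i := x_block i.
have vu i : phi (S10_v i) <> phi (S10_u i) := elimN eqP (pr i true).
have wu i : phi (S10_w i) <> phi (S10_u i) := elimN eqP (pr i false).
have vw i : phi (S10_v i) <> phi (S10_w i) := elimN eqP (pp i true).
case=> [|i|i|i] [|j|j|j] // phi_eq.
(* First [z] against a block; then disjointness of the blocks equates the indices, and distinctness
   within one block settles the rest. *)
all: try by [have := z_notin j; rewrite phi_eq ?u_in ?v_in ?w_in
            |have := z_notin i; rewrite -phi_eq ?u_in ?v_in ?w_in].
all: have ij : i = j by apply: block_inj phi_eq.
all: by rewrite -ij in phi_eq *;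
  first [done | by case: (vu i) | by case: (wu i) | by case: (vw i)].
Qed.

End SylvesterColouring.

Theorem corollary3p9 (H : mgraph) (Hconn : connected H)
    (Hcol : forall G : mgraph, cubic G -> colours H G) :
  isomorphic H S10.
Proof.
have [f [fproper fstar]] := Hcol _ cubic_S10.
(* Boolean equality lets [xchoose] turn the existential into a function without a choice axiom. *)
have phi_spec y : exists v, f @: incident y == incident v.
  by have [v fv] := fstar y; exists v; apply/eqP.
pose phi y := xchoose (phi_spec y).
have phiE y : f @: incident y = incident (phi y).
  exact/eqP/(xchooseP (phi_spec y)).
apply: isomorphic_sym.
apply: (injective_colouring_isomorphic (S10_z : vertex S10) Hconn fproper phiE).
exact: S10_colouring_vertex_inj fproper phiE.
Qed.
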